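(* Let $\mathcal{D}$ be a domain in a Banach space $X$ and let $\mathcal{F}=\{F_t\}_{t\ge 0}\subset C(\mathcal{D})$ be a one-parameter continuous semigroup on $\mathcal{D}$ that is $T$-continuous and $T$-Lipschitzian. Then the limit (in the norm of $X$) \[ f(x)=\lim_{t\to 0^+}\frac1t\bigl(F_t(x)-x\bigr) \] exists for all $x\in\mathcal{D}$, uniformly on subsets that lie strictly inside $\mathcal{D}$. Moreover, $f\in C(\mathcal{D},X)$ and $f$ is bounded on every set that lies strictly inside $\mathcal{D}$. In turn, the mapping $u$ defined by $u(t,x)=F_t(x)$, $(t,x)\in[0,\infty)\times\mathcal{D}$, solves the Cauchy problem \[ \frac{d u(t,x)}{dt}=f(u(t,x)),\qquad u(0,x)=x\in\mathcal{D}. \]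
   Context: $X$ is a real or complex Banach space. A domain is a connected open set. $C(\mathcal{D},Y)$ is the set of continuous mappings from $\mathcal{D}$ to $Y$, and $C(\mathcal{D})$ is the set of continuous self-mappings of $\mathcal{D}$. $\mathrm{Id}$ denotes the identity mapping. A bounded subset $\hat{\mathcal{D}}\subset\mathcal{D}$ lies strictly inside $\mathcal{D}$ if $\inf_{x\in\hat{\mathcal{D}}}\operatorname{dist}(x,\partial\mathcal{D})>0$ (with distance to the empty set being $+\infty$). A family $\{f_t\}_{t\ge0}\subset C(\mathcal{D},Y)$ ($Y$ a Banach space) is jointly continuous if for every $(t_0,x_0)\in[0,\infty)\times\mathcal{D}$ one has $\lim_{t\to t_0,\,x\to x_0}f_t(x)=f_{t_0}(x_0)$. It is $T$-continuous (locally uniformly continuous) if for every $t_0\ge0$ and every subset $\hat{\mathcal{D}}$ strictly inside $\mathcal{D}$, $\sup_{x\in\hat{\mathcal{D}}}\|f_t(x)-f_{t_0}(x)\|\to0$ as $t\to t_0$. A one-parameter continuous semigroup (semigroup) on $\mathcal{D}$ is a jointly continuous family $\{F_t\}_{t\ge0}\subset C(\mathcal{D})$ such that $F_{t+s}=F_t\circ F_s$ for all $t,s\ge0$ and $\lim_{t\to0^+}F_t(x)=x$ for all $x\in\mathcal{D}$. For $\hat{\mathcal{D}}$ strictly inside $\mathcal{D}$ with $\operatorname{dist}(\hat{\mathcal{D}},\partial\mathcal{D})>\mu>0$ and a mapping $F$ on $\mathcal{D}$, put \[ \operatorname{Lip}_{\hat{\mathcal{D}},\mu}(F):=\sup_{x\in\hat{\mathcal{D}},\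 \|x-\tilde x\|\le\mu,\ x\ne\tilde x}\frac{\|F(x)-F(\tilde x)\|}{\|x-\tilde x\|}. \] A semigroup $\{F_t\}_{t\ge0}\subset C(\mathcal{D})$ is $T$-Lipschitzian (locally uniformly Lipschitzian) if for every subset $\hat{\mathcal{D}}$ strictly inside $\mathcal{D}$ and every $\mu$ with $\operatorname{dist}(\hat{\mathcal{D}},\partial\mathcal{D})>\mu>0$, $\operatorname{Lip}_{\hat{\mathcal{D}},\mu}(F_t-\mathrm{Id})\to0$ as $t\to0^+$. *)

(* Defs.v *)
From HB Require Import structures.
From mathcomp Require Import all_boot all_order all_algebra complex.
From mathcomp Require Import all_classical all_reals all_analysis.
Export numFieldNormedType.Exports.

Set Implicit Arguments.
Unset Strict Implicit.
Unset Printing Implicit Defensive.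

Import Order.TTheory GRing.Theory Num.Theory.

Local Open Scope classical_set_scope.
Local Open Scope ring_scope.

(* "X is a real or complex Banach space" is rendered as
   [X : completeNormedModType (scalar_field R k)] with [k] arbitrary. The norm of X
   takes its values in [scalar_field R k], so in the complex case it is a complex
   number with zero imaginary part; [rnorm] is its value as a real number. Time
   is always real and acts on X through [ofreal]. *)
Variant scalar_kind := RealScalars | ComplexScalars.

Definition scalar_field (R : realType) (k : scalar_kind) : numFieldType :=
  match k with RealScalars => R | ComplexScalars => R[i] end.

Definition ofreal (R : realType) (k : scalar_kind) : R -> scalar_field R k :=
  match k with
  | RealScalars => fun t => t
  | ComplexScalars => fun t => real_complex R t
  end.

Definition toreal (R : realType) (k : scalar_kind) : scalar_field R k -> R :=
  match k with
  | RealScalars => fun z => z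
  | ComplexScalars => fun z => complex.Re z
  end.

Section Semigroups.
Context {R : realType} {k : scalar_kind} {X : completeNormedModType (scalar_field R k)}.
Implicit Types (D E : set X) (F u : R -> X -> X) (f g : X -> X).

Definition rnorm (x : X) : R := toreal `|x|.

Definition halfline : set R := [set t | 0 <= t].

Definition domain D : Prop := open D /\ connected D.

Definition boundary D : set X := closure D `\` D°.

(* The infimum of the empty set is +oo. *)
Definition dist (x : X) (A : set X) : \bar R :=
  ereal_inf [set (rnorm (x - a))%:E | a in A].

Definition dist_set (B A : set X) : \bar R := ereal_inf [set dist x A | x in B].

Definition strictly_inside D E : Prop :=
  [/\ E `<=` D, bounded_set E & (0 < dist_set E (boundary D))%E].

(* Supremum of a set of nonnegative reals. Adding 0 makes the supremum of the
   empty set 0 rather than -oo and changes nothing otherwise. *)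
Definition nnsup (A : set R) : \bar R := ereal_sup [set r%:E | r in 0 |` A].

(* Mappings on D are represented by functions on X whose values outside D are
   irrelevant; families indexed by [0, oo[ by functions on R whose values at
   negative times are irrelevant. *)

Definition self_map D g : Prop :=
  {within D, continuous g} /\ (forall x, D x -> D (g x)).

Definition jointly_continuous D F : Prop :=
  {within halfline `*` D, continuous (fun p : R * X => F p.1 p.2)}.

Definition T_continuous D F : Prop :=
  forall t0, 0 <= t0 -> forall E, strictly_inside D E ->
    nnsup [set rnorm (F t x - F t0 x) | x in E]
      @[t --> within halfline (nbhs t0)] --> 0%E.

Definition semigroup D F : Prop :=
  [/\ forall t, 0 <= t -> self_map D (F t),
      jointly_continuous D F,
      forall t s, 0 <= t -> 0 <= s -> forall x, D x ->
        F (t + s) x = F t (F s x)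
    & forall x, D x -> F t x @[t --> 0^'+] --> x].

(* When mu < dist(E, boundary of D), the second component of p automatically lies in D. *)
Definition Lip E (mu : R) g : \bar R :=
  nnsup [set rnorm (g p.1 - g p.2) / rnorm (p.1 - p.2) | p in
         [set p : X * X | [/\ E p.1, rnorm (p.1 - p.2) <= mu & p.1 <> p.2]]].

Definition T_Lipschitzian D F : Prop :=
  forall E (mu : R), strictly_inside D E ->
    0 < mu -> (mu%:E < dist_set E (boundary D))%E ->
    Lip E mu (fun x => F t x - x) @[t --> 0^'+] --> 0%E.

Definition diff_quotient F (t : R) (x : X) : X :=
  (ofreal k t)^-1 *: (F t x - x).

(* The time derivative on [0, oo[ is two-sided for t > 0 and one-sided at 0. *)
Definition solves_Cauchy D f u : Prop :=
  forall x, D x -> u 0 x = x /\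
    forall t, 0 <= t -> D (u t x) /\
      (ofreal k (s - t))^-1 *: (u s x - u t x)
        @[s --> within halfline t^'] --> f (u t x).

End Semigroups.

(* Main.v *)
(* Put G_x(t) = F_t(x) - x. For E strictly inside D and every eps > 0, the semigroup
   law and the smallness of Lip(F_s - Id) give, for s, t in [0, delta] and uniformly
   in x in E,
     |G_x(s + t) - G_x(s) - G_x(t)| = |(F_s - Id)(F_t x) - (F_s - Id)(x)|
                                   <= eps |G_x(t)|.
   Summing over multiples of t yields |G_x(n t) - n G_x(t)| <= n eps |G_x(t)|. With
   eps = 1/2 and n t close to delta this bounds G_x(t)/t; with eps small and n t
   close to s it shows that G_x(s)/s and G_x(t)/t are close once t is much smaller
   than s. Hence the slopes are Cauchy as t -> 0+, uniformly on E. *)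
Require Import Defs.
From HB Require Import structures.
From mathcomp Require Import all_boot all_order all_algebra complex.
From mathcomp Require Import all_classical all_reals all_analysis.
From mathcomp Require Import ring lra.

Import Order.TTheory GRing.Theory Num.Theory.

Local Open Scope classical_set_scope.
Local Open Scope ring_scope.

(** * Real numbers inside the scalar field *)

Section Scalars.
Context {R : realType} {k : scalar_kind}.

Fact ofreal_is_zmod_morphism : zmod_morphism (@ofreal R k).
Proof. by case: k => //= x y; exact: rmorphB. Qed.

Fact ofreal_is_monoid_morphism : monoid_morphism (@ofreal R k).
Proof. by case: k => //=; split=> [|x y]; [exact: rmorph1|exact: rmorphM]. Qed.

HB.instance Definition _ :=
  GRing.isZmodMorphism.Build R (scalar_field R k) (@ofreal R k)
    ofreal_is_zmod_morphism.
HB.instance Definition _ :=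
  GRing.isMonoidMorphism.Build R (scalar_field R k) (@ofreal R k)
    ofreal_is_monoid_morphism.

Lemma ltr_ofreal (s t : R) : (ofreal k s < ofreal k t) = (s < t).
Proof. by case: k => //=; exact: ltcR. Qed.

Lemma ler_ofreal (s t : R) : (ofreal k s <= ofreal k t) = (s <= t).
Proof. by case: k => //=; exact: lecR. Qed.

Lemma ofreal_toreal (z : scalar_field R k) : 0 <= z -> ofreal k (toreal z) = z.
Proof. by case: k z => //= z /ger0_real /RRe_real. Qed.

Lemma normr_ofreal (t : R) : `|ofreal k t| = ofreal k `|t|.
Proof.
case: (leP 0 t) => t0.
  by rewrite !ger0_norm// -(rmorph0 (@ofreal R k)) ler_ofreal.
rewrite !ltr0_norm ?rmorphN//.
by rewrite -(rmorph0 (@ofreal R k)) ltr_ofreal.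
Qed.

End Scalars.

(** * The real-valued norm, and the topology of [X] expressed through it *)

Section RealNorm.
Context {R : realType} {k : scalar_kind} {X : completeNormedModType (scalar_field R k)}.
Implicit Types x y z : X.

Lemma normr_rnorm x : `|x| = ofreal k (rnorm x).
Proof. by rewrite ofreal_toreal. Qed.

Lemma rnorm_ge0 x : 0 <= rnorm x.
Proof. by rewrite -(@ler_ofreal R k) rmorph0 -normr_rnorm. Qed.

Lemma rnormN x : rnorm (- x) = rnorm x.
Proof. by rewrite /rnorm normrN. Qed.

Lemma rnormBC x y : rnorm (x - y) = rnorm (y - x).
Proof. by rewrite /rnorm distrC. Qed.

Lemma rnormD x y : rnorm (x + y) <= rnorm x + rnorm y.
Proof. by rewrite -(@ler_ofreal R k) rmorphD/= -!normr_rnorm ler_normD. Qed.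

Lemma rnormB_trans z x y : rnorm (x - y) <= rnorm (x - z) + rnorm (z - y).
Proof. by rewrite -[x - y](subrKA z) rnormD. Qed.

Lemma rnormZ (t : R) x : rnorm (ofreal k t *: x) = `|t| * rnorm x.
Proof.
apply: (fmorph_inj (@ofreal R k)).
by rewrite rmorphM/= -!normr_rnorm normrZ normr_ofreal.
Qed.

Lemma rnorm0 : rnorm (0 : X) = 0.
Proof. by rewrite -(scale0r 0) -(rmorph0 (@ofreal R k)) rnormZ normr0 mul0r. Qed.

Lemma rnorm_gt0 x : (0 < rnorm x) = (x != 0).
Proof.
by rewrite -(@ltr_ofreal R k) rmorph0 -normr_rnorm normr_gt0.
Qed.

(** Positivity in [R[i]] forces a zero imaginary part, so the radius of every ball or entourage of
    [X] comes from a real number. *)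
Lemma gt0_scalarP (e : scalar_field R k) : 0 < e -> exists2 r, 0 < r & e = ofreal k r.
Proof.
move=> e0; exists (toreal e); last by rewrite ofreal_toreal// ltW.
by rewrite -(@ltr_ofreal R k) rmorph0 ofreal_toreal// ltW.
Qed.

Lemma ball_rnorm x y (r : R) : ball x (ofreal k r) y <-> rnorm (x - y) < r.
Proof. by rewrite -ball_normE /ball_/= normr_rnorm ltr_ofreal. Qed.

Lemma nbhs_rnormP x (P : set X) :
  nbhs x P <-> exists2 r, 0 < r & forall y, rnorm (x - y) < r -> P y.
Proof.
split=> [/nbhs_ballP[_ /= /gt0_scalarP[r r0 ->] rP]|[r r0 rP]].
  by exists r => // y /ball_rnorm /rP.
apply/nbhs_ballP; exists (ofreal k r) => [/=|y /ball_rnorm /rP//].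
by rewrite -(rmorph0 (@ofreal R k)) ltr_ofreal.
Qed.

Lemma cvg_rnormP {T : Type} {G : set_system T} {FG : Filter G} (f : T -> X) (l : X) :
  f @ G --> l <-> forall r, 0 < r -> \forall t \near G, rnorm (l - f t) < r.
Proof.
split=> [fl r r0|fl].
  by apply: (fl [set y | rnorm (l - y) < r]); apply/nbhs_rnormP; exists r.
move=> P /nbhs_rnormP[r r0 rP].
by apply: filterS (fl r r0) => t /rP.
Qed.


Lemma rnorm_bounded_set (A : set X) (M : R) :
  (forall x, A x -> rnorm x <= M) -> bounded_set A.
Proof.
move=> AM; exists (ofreal k M); split.
  by rewrite realE -!(rmorph0 (@ofreal R k)) !ler_ofreal le_total.
move=> e Me x /AM xM; apply: le_trans (ltW Me).
by rewrite normr_rnorm ler_ofreal.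
Qed.

End RealNorm.

(** * Growth and slope estimates for quasi-additive curves *)

Section QuasiAdditive.
Context {R : realType} {k : scalar_kind} {X : completeNormedModType (scalar_field R k)}.
Implicit Types (G : R -> X) (s t r eps delta C M : R).

(** The error is measured by [G t] alone, not by [G s]: repeated steps of the same length [t] then
    all cost the same. *)
Definition quasi_additive delta eps G : Prop :=
  forall s t, 0 <= s <= delta -> 0 <= t <= delta ->
    rnorm (G (s + t) - G s - G t) <= eps * rnorm (G t).

Lemma quasi_additiveW delta delta' eps G :
  delta' <= delta -> quasi_additive delta eps G -> quasi_additive delta' eps G.
Proof.
by move=> dd qG s t /andP[s0 sd] /andP[t0 td]; apply: qG; rewrite (s0, t0)/=;
  exact: le_trans dd.
Qed.

(** Telescoping: each of the [n] steps of length [t] contributes [G t] up to [eps * rnorm (G t)].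
    The offset [r] will be the remainder in a division of times. *)
Lemma quasi_additive_natmul delta eps G n r t : quasi_additive delta eps G ->
  0 <= r -> 0 <= t -> r + n%:R * t <= delta ->
  rnorm (G (r + n%:R * t) - G r - G t *+ n) <= n%:R * eps * rnorm (G t).
Proof.
move=> qG r0 t0; elim: n => [|n IH] rtd.
  by rewrite mul0r addr0 mulr0n subr0 subrr rnorm0 !mul0r.
have nt0 : 0 <= n%:R * t by rewrite mulr_ge0.
have ntd : r + n%:R * t + t <= delta by move: rtd; rewrite -natr1; lra.
have -> : r + n.+1%:R * t = r + n%:R * t + t by rewrite -natr1; ring.
rewrite mulrSr.
have -> : G (r + n%:R * t + t) - G r - (G t *+ n + G t) =
    (G (r + n%:R * t + t) - G (r + n%:R * t) - G t) +
    (G (r + n%:R * t) - G r - G t *+ n).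
  move: (G (_ + t)) (G (r + _)) (G r) (G t) (G t *+ n) => a b c d e.
  by rewrite -[a - c](subrKA b) [e + d]addrC opprD addrACA.
apply: le_trans (rnormD _ _) _.
have := IH ltac:(lra).
have := qG (r + n%:R * t) t ltac:(apply/andP; split; lra) ltac:(apply/andP; split; lra).
by rewrite -natr1 => *; lra.
Qed.

(** With [n] the integer part of [delta / t], the telescoping error is at most half of
    [n * rnorm (G t)] and can be absorbed, so [n * rnorm (G t) <= 2 * M]. As [n >= 1], also
    [delta < (n + 1) * t <= 2 * n * t]; the two factors 2 give the 4. *)
Lemma quasi_additive_lin_bound delta eps G M t : quasi_additive delta eps G ->
  eps <= 2^-1 -> G 0 = 0 -> (forall s, 0 <= s <= delta -> rnorm (G s) <= M) ->
  0 < t <= delta -> delta * rnorm (G t) <= 4 * M * t.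
Proof.
move=> qG eps2 G0 GM /andP[t0 td]; set n := Num.truncn (delta / t).
have /andP[nt dn] : n%:R <= delta / t < n.+1%:R.
  by rewrite truncn_itv// divr_ge0//; lra.
have n1 : (1 : R) <= n%:R.
  by rewrite ler1n truncn_gt0 ler_pdivlMr// mul1r.
move: nt dn; rewrite ler_pdivlMr// ltr_pdivrMr// -natr1 => nt dn.
have nt0 : 0 <= n%:R * t by rewrite mulr_ge0// ltW.
have := quasi_additive_natmul _ _ _ n 0 t qG (lexx _) (ltW t0).
rewrite add0r G0 subr0 => /(_ nt) => h.
have GMn := GM (n%:R * t) ltac:(apply/andP; split; lra).
have nG : rnorm (G t *+ n) = n%:R * rnorm (G t).
  by rewrite -scaler_nat -(rmorph_nat (@ofreal R k)) rnormZ normr_nat.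
have := rnormB_trans (G (n%:R * t)) (G t *+ n) 0.
rewrite !subr0 nG rnormBC => tri.
have g0 := rnorm_ge0 (G t).
have ng : n%:R * eps * rnorm (G t) <= n%:R * rnorm (G t) / 2.
  have : n%:R * (eps * rnorm (G t)) <= n%:R * (2^-1 * rnorm (G t)).
    by rewrite ler_wpM2l// ler_wpM2r.
  by lra.
have ng2 : n%:R * rnorm (G t) <= 2 * M by lra.
have : t * (n%:R * rnorm (G t)) <= t * (2 * M) by rewrite ler_wpM2l// ltW.
have : delta * rnorm (G t) <= (2 * n%:R * t) * rnorm (G t).
  by rewrite ler_wpM2r//; nra.
by nra.
Qed.

(** Divide with remainder, [s = n * t + r] with [0 <= r < t]. The telescoping error is at most
    [eps * C * s], the remainder terms at most [2 * C * t]; then divide by [s]. *)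
Lemma quasi_additive_slope delta eps G C s t : quasi_additive delta eps G ->
  0 <= eps -> (forall r, 0 <= r <= delta -> rnorm (G r) <= C * r) ->
  0 < t -> t <= s -> s <= delta ->
  rnorm ((ofreal k s)^-1 *: G s - (ofreal k t)^-1 *: G t) <=
    eps * C + 2 * C * t / s.
Proof.
move=> qG e0 GC t0 ts sd; have s0 : 0 < s by exact: lt_le_trans ts.
have td : t <= delta by exact: le_trans sd.
set n := Num.truncn (s / t).
have /andP[nt dn] : n%:R <= s / t < n.+1%:R.
  by rewrite truncn_itv// divr_ge0//; lra.
move: nt dn; rewrite ler_pdivlMr// ltr_pdivrMr// -natr1 => nt dn.
have nt0 : 0 <= n%:R * t by rewrite mulr_ge0// ltW.
set r := s - n%:R * t.
have r0 : 0 <= r by rewrite /r; lra.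
have rt : r < t by rewrite /r; lra.
have sE : r + n%:R * t = s by rewrite /r subrK.
have C0 : 0 <= C.
  have := GC t ltac:(apply/andP; split; lra).
  by move=> /(le_trans (rnorm_ge0 _)); rewrite pmulr_lge0.
have GCt := GC t ltac:(apply/andP; split; lra).
have GCr := GC r ltac:(apply/andP; split; lra).
have := quasi_additive_natmul _ _ _ n r t qG r0 (ltW t0); rewrite sE => /(_ sd) h.
rewrite -!fmorphV.
(* The coefficients of [G t] match because [n + r / t = s / t]. *)
have -> : ofreal k s^-1 *: G s - ofreal k t^-1 *: G t =
  ofreal k s^-1 *: (G s - G r - G t *+ n + (G r - ofreal k (r / t) *: G t)).
  rewrite [_ + (G r - _)]addrA [G s - G r - _ + G r]addrAC subrK scalerBr.
  rewrite scalerBr -addrA -opprD -scalerDr -scaler_nat -(rmorph_nat (@ofreal R k)).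
  rewrite -scalerDl -rmorphD/= scalerA -rmorphM/=.
  congr (_ - ofreal k _ *: _).
  by rewrite /r; field; rewrite !gt_eqF.
rewrite rnormZ gtr0_norm ?invr_gt0// mulrC.
rewrite ler_pdivrMr//.
have -> : (eps * C + 2 * C * t / s) * s = eps * C * s + 2 * C * t.
  by field; rewrite gt_eqF.
apply: le_trans (rnormD _ _) _.
have h1 : n%:R * eps * rnorm (G t) <= eps * C * s.
  have : n%:R * eps * rnorm (G t) <= n%:R * eps * (C * t).
    by rewrite ler_wpM2l// mulr_ge0.
  have : eps * C * (n%:R * t) <= eps * C * s by rewrite ler_wpM2l// mulr_ge0.
  by lra.
have h2 : rnorm (G r - ofreal k (r / t) *: G t) <= 2 * C * t.
  apply: le_trans (rnormD _ _) _; rewrite rnormN rnormZ ger0_norm; last first.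
    by rewrite divr_ge0// ltW.
  have : C * r <= C * t by rewrite ler_wpM2l// ltW.
  have : r / t * rnorm (G t) <= 1 * (C * t).
    apply: ler_pM => //; [by rewrite divr_ge0// ltW|exact: rnorm_ge0|].
    by rewrite ler_pdivrMr// mul1r ltW.
  by lra.
by lra.
Qed.

End QuasiAdditive.

(** * Sets strictly inside [D] and first consequences of the semigroup axioms *)

Section Semigroup.
Context {R : realType} {k : scalar_kind} {X : completeNormedModType (scalar_field R k)}.
Implicit Types (x y : X) (D E : set X) (s t r : R).

Lemma at_right0P (P : set R) :
  (\forall t \near 0^'+, P t) <-> exists2 r, 0 < r & forall t, 0 < t < r -> P t.
Proof.
split=> [/nbhs_ballP[r /= r0 rP]|[r r0 rP]].
  exists r => // t /andP[t0 tr]; apply: rP => //.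
  by rewrite /ball/= sub0r normrN gtr0_norm.
near=> t; apply: rP; apply/andP; split; near: t.
  exact: nbhs_right_gt.
exact: nbhs_right_lt.
Unshelve. all: by end_near. Qed.

(** Converts the vanishing suprema in [T_continuous] and [T_Lipschitzian] into real bounds valid for
    all points at once. *)
Lemma nnsup_cvg0 {T : Type} {G : set_system T} {FG : Filter G} (A : T -> set R) r :
  0 < r -> nnsup (A t) @[t --> G] --> 0%E ->
  \forall t \near G, forall a, A t a -> a <= r.
Proof.
move=> r0 A0.
have : \forall t \near G, (nnsup (A t) < r%:E)%E.
  apply: (A0 [set y | (y < r%:E)%E]); apply: open_nbhs_nbhs.
  by split; [exact: open_ereal_lt_ereal|rewrite /= lte_fin].
apply: filterS => t Atr a Aa; rewrite -lee_fin; apply: le_trans (ltW Atr).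
by apply: ereal_sup_ubound; exists a => //; right.
Qed.

(** Since [D] is open, boundary points lie outside [D], hence at distance at least [r] from [x] if
    the [r]-ball is in [D]; half the radius leaves a margin [r / 2]. This makes the uniform
    estimates available near any point. *)
Lemma strictly_inside_ball D x : open D -> D x ->
  exists2 r, 0 < r & strictly_inside D [set y | rnorm (x - y) < r].
Proof.
move=> oD Dx.
have /nbhs_rnormP[r r0 rD] : nbhs x D by exact: open_nbhs_nbhs.
exists (r / 2); first by rewrite divr_gt0.
split.
- by move=> y /= xy; apply: rD; apply: lt_le_trans xy _; lra.
- apply: (@rnorm_bounded_set _ _ _ _ (rnorm x + r)) => y /= xy.
  have := rnormB_trans x y 0; rewrite !subr0 rnormBC.
  by move: xy; lra.
- apply: (@lt_le_trans _ _ (r / 2)%:E); first by rewrite lte_fin divr_gt0.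
  apply/ereal_infP => _ [y /= xy <-]; apply/ereal_infP => _ [z [_ Dz] <-].
  rewrite lee_fin leNgt; apply/negP => yz; apply: Dz.
  rewrite (interior_id _).1//; apply: rD.
  by have := rnormB_trans y x z; lra.
Qed.

Lemma strictly_inside_dist D E : strictly_inside D E ->
  exists2 mu : R, 0 < mu & (mu%:E < dist_set E (boundary D))%E.
Proof.
move=> [_ _]; case: (dist_set _ _) => [d| |//].
  rewrite lte_fin => d0; exists (d / 2); first by rewrite divr_gt0.
  by rewrite lte_fin; lra.
(* Infinite distance, as for an empty boundary: any positive [mu] would do. *)
by exists 1 => //; rewrite ltry.
Qed.

Context (D : set X) (F : R -> X -> X).
Hypotheses (oD : open D) (sgF : semigroup D F).
Hypotheses (TF : T_continuous D F) (LF : T_Lipschitzian D F).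

Lemma semigroup_invariant t x : 0 <= t -> D x -> D (F t x).
Proof. by case: sgF => + _ _ _ t0 Dx => /(_ t t0)[_]; apply. Qed.

Lemma orbit_cvg t x : 0 <= t -> D x ->
  F s x @[s --> within halfline (nbhs t)] --> F t x.
Proof.
case: sgF => _ /subspace_continuousP jF _ _ t0 Dx.
have := jF (t, x) (conj t0 Dx); apply: cvg_trans.
move=> P /= [[A B] /= [tA xB] ABP].
rewrite /within/=; apply: filterS tA => s As s0.
apply: (ABP (s, x)); last by split.
by split=> //=; exact: nbhs_singleton.
Qed.

(** Uniqueness of limits: as [t] tends to 0 from the right, [F t x] tends to [x] by the semigroup
    axiom and to [F 0 x] by joint continuity. *)
Lemma semigroup0 x : D x -> F 0 x = x.
Proof.
move=> Dx; case: (sgF) => _ _ _ /(_ x Dx); apply: cvg_unique.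
  exact: norm_hausdorff.
apply: cvg_trans (orbit_cvg 0 x (lexx _) Dx); apply: cvg_app => P /=.
apply: (@filterS _ (nbhs (0 : R)) _ (fun t => halfline t -> P t)) => t tP t0.
by apply: tP; exact: ltW.
Qed.

Lemma semigroup_near0 E r : strictly_inside D E -> 0 < r ->
  exists2 delta, 0 < delta & forall x t, E x -> 0 <= t <= delta ->
    rnorm (F t x - x) <= r.
Proof.
move=> sE r0; have [ED _ _] := sE.
have /(_ _)/nbhs_ballP[d /= d0 dP] := nnsup_cvg0 _ _ r0 (TF 0 (lexx 0) E sE).
(* The ball of radius [d] is open, the time interval claimed is closed. *)
exists (d / 2); first by rewrite divr_gt0.
move=> x t Ex /andP[t0 td].
rewrite -[x in _ - x]semigroup0; last exact: ED.
apply: (dP t) => //; last by exists x.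
by rewrite /ball/= sub0r normrN ger0_norm//; lra.
Qed.

(** * Linear growth of displacements and the Cauchy estimate for slopes *)

Definition displacement x t : X := F t x - x.

(* The Lipschitz constant of [F s - Id] is applied to the pair [x], [F t x]. *)
Lemma displacement_quasi_additive E eps : strictly_inside D E -> 0 < eps ->
  exists2 delta, 0 < delta &
    forall x, E x -> quasi_additive delta eps (displacement x).
Proof.
move=> sE eps0; have [ED _ _] := sE.
have [mu mu0 muE] := strictly_inside_dist _ _ sE.
have [d1 d10 d1P] := semigroup_near0 _ _ sE mu0.
have /(_ _)/at_right0P[d2 d20 d2P] := nnsup_cvg0 _ _ eps0 (LF E mu sE mu0 muE).
(* [d1] keeps [F t x] within [mu] of [x], as [Lip] demands; [d2 / 2] keeps [s] where the Lipschitz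
   constant is at most [eps]. *)
exists (Num.min d1 (d2 / 2)); first by rewrite lt_min d10 divr_gt0.
move=> x Ex s t /andP[s0]; rewrite le_min => /andP[sd1 sd2].
move=> /andP[t0]; rewrite le_min => /andP[td1 td2].
have Dx := ED x Ex.
have ge0 : 0 <= eps * rnorm (displacement x t).
  by rewrite mulr_ge0 ?rnorm_ge0// ltW.
(* The Lipschitz bound holds only for [s > 0]; at [s = 0] the error vanishes. *)
have [->|sN0] := eqVneq s 0.
  by rewrite add0r /displacement semigroup0// subrr subr0 subrr rnorm0.
case: (sgF) => _ _ FD _; have Fst := FD s t s0 t0 x Dx.
have -> : displacement x (s + t) - displacement x s - displacement x t =
    F s (F t x) - F t x - (F s x - x).
  rewrite /displacement Fst; move: (F s (F t x)) (F s x) (F t x) => a b c.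
  by rewrite addrAC; congr (_ - _); rewrite opprB addrA subrK.
(* [Lip] ranges over distinct points, so a fixed point of [F t] is treated apart. *)
have [xF|xF] := pselect (x = F t x).
  by rewrite -xF subrr rnorm0.
rewrite rnormBC /displacement [rnorm (F t x - x)]rnormBC -ler_pdivrMr; last first.
  by rewrite rnorm_gt0 subr_eq0; apply/eqP.
apply: (d2P s); first by rewrite lt_neqAle eq_sym sN0 s0/=; lra.
exists (x, F t x) => //=; split=> //=; rewrite rnormBC.
by apply: d1P => //; rewrite t0.
Qed.

(** [T_continuous] at time 0 bounds displacements by [M = 1]; quasi-additivity with constant 1/2
    upgrades this to linear growth, with [C = 4 / d]. *)
Lemma displacement_lin_bound E : strictly_inside D E ->
  exists2 delta, 0 < delta & exists2 C, 0 <= C &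
    forall x t, E x -> 0 <= t <= delta -> rnorm (displacement x t) <= C * t.
Proof.
move=> sE; have [ED _ _] := sE.
have [d1 d10 d1P] := semigroup_near0 _ _ sE ltr01.
have [|d2 d20 d2P] := displacement_quasi_additive E 2^-1 sE.
  by rewrite invr_gt0.
pose d := Num.min d1 d2; have d0 : 0 < d by rewrite lt_min d10.
exists d => //; exists (4 / d); first by rewrite divr_ge0// ltW.
move=> x t Ex /andP[]; rewrite le_eqVlt => /predU1P[<-|t0] td.
  by rewrite /displacement semigroup0 ?subrr ?rnorm0 ?mulr0//; exact: ED.
have := @quasi_additive_lin_bound R k X d 2^-1 (displacement x) 1 t.
rewrite mulr1 mulrAC ler_pdivlMr// mulrC; apply => //.
- by apply: (quasi_additiveW d2); [rewrite ge_min lexx orbT|exact: d2P].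
- by rewrite /displacement semigroup0 ?subrr//; exact: ED.
- move=> s /andP[s0 sd]; apply: d1P => //; rewrite s0/=.
  by apply: le_trans sd _; rewrite ge_min lexx.
- by rewrite t0.
Qed.

Lemma diff_quotient_cauchy E eta : strictly_inside D E -> 0 < eta ->
  exists2 tau, 0 < tau & forall x s t, E x -> 0 < s < tau -> 0 < t < tau ->
    rnorm (diff_quotient F s x - diff_quotient F t x) <= eta.
Proof.
move=> sE eta0.
have [d1 d10 [C C0 CP]] := displacement_lin_bound _ sE.
(* [C] is fixed before [eps], which makes [eps * C <= eta / 4]; [C + 1] avoids dividing by a
   possibly zero [C]. *)
pose eps := eta / (4 * (C + 1)).
have eps0 : 0 < eps by rewrite divr_gt0//; lra.
have epsC : eps * C <= eta / 4.
  have -> : eta / 4 = eps * (C + 1) by rewrite /eps; field; apply/eqP; lra.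
  by rewrite ler_wpM2l ?ltW//; lra.
have [d2 d20 d2P] := displacement_quasi_additive _ _ sE eps0.
pose d := Num.min d1 d2; have d0 : 0 < d by rewrite lt_min d10.
(* The second entry gives [2 * C * t / d <= eta / 4] for [t < tau]; the entry 1 gives [tau <= d]. *)
pose tau := d * Num.min 1 (eta / (8 * (C + 1))).
have tau0 : 0 < tau.
  by rewrite mulr_gt0// lt_min ltr01/= divr_gt0//; lra.
have tau_d : tau <= d by rewrite ger_pMr// ge_min lexx.
(* Small times are not compared directly: both slopes are compared with the one at the fixed time
   [d]. *)
have near_d x t : E x -> 0 < t < tau ->
    rnorm (diff_quotient F d x - diff_quotient F t x) <= eta / 2.
  move=> Ex /andP[t0 ttau].
  apply: (@le_trans _ _ (eps * C + 2 * C * t / d)).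
    apply: (@quasi_additive_slope R k X d eps (displacement x) C d t) => //.
    - by apply: (quasi_additiveW d2); [rewrite ge_min lexx orbT|exact: d2P].
    - exact: ltW.
    - move=> r /andP[r0 rd]; apply: CP => //; rewrite r0/=.
      by apply: le_trans rd _; rewrite ge_min lexx.
    - by apply: le_trans tau_d; exact: ltW.
  have td : t / d <= eta / (8 * (C + 1)).
    rewrite ler_pdivrMr// mulrC; apply: le_trans (ltW ttau) _.
    by rewrite ler_pM2l// ge_min lexx orbT.
  have : 2 * C * (t / d) <= 2 * (C + 1) * (eta / (8 * (C + 1))).
    by apply: ler_pM => //; [lra|rewrite divr_ge0// ltW|lra].
  have -> : 2 * (C + 1) * (eta / (8 * (C + 1))) = eta / 4.
    by field; apply/eqP; lra.
  by move: epsC; rewrite mulrA; lra.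
exists tau => // x s t Ex sP tP.
apply: le_trans (rnormB_trans (diff_quotient F d x) _ _) _.
rewrite rnormBC; have := near_d x s Ex sP; have := near_d x t Ex tP; lra.
Qed.

(** * The generator and the differentiability of orbits *)

Definition generator x : X := lim (diff_quotient F t x @[t --> 0^'+]).

(** Completeness of [X] and the Cauchy estimate on a small ball around [x] make [lim] a genuine
    limit on [D], not a default value. *)
Lemma generator_cvg x : D x -> diff_quotient F t x @[t --> 0^'+] --> generator x.
Proof.
move=> Dx; apply: cauchy_cvg; apply: cauchy_exP => _ /= /gt0_scalarP[e e0 ->].
have [r r0 rP] := strictly_inside_ball _ _ oD Dx.
have [|tau tau0 tauP] := diff_quotient_cauchy _ (e / 2) rP.
  by rewrite divr_gt0.
exists (diff_quotient F (tau / 2) x); apply/at_right0P.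
exists tau => // t tP; apply/ball_rnorm.
apply: (@le_lt_trans _ _ (e / 2)); last lra.
apply: tauP => //; first by rewrite /= subrr rnorm0.
by apply/andP; split; lra.
Qed.

(** Let one time tend to 0 in the Cauchy estimate. The auxiliary time [s] depends on [x], but [tau]
    does not. *)
Lemma generator_unif E eta : strictly_inside D E -> 0 < eta ->
  exists2 tau, 0 < tau & forall x t, E x -> 0 < t < tau ->
    rnorm (generator x - diff_quotient F t x) <= eta.
Proof.
move=> sE eta0; have [ED _ _] := sE.
have [|tau tau0 tauP] := diff_quotient_cauchy E (eta / 2) sE.
  by rewrite divr_gt0.
exists tau => // x t Ex tP.
have /cvg_rnormP/(_ (eta / 2))/(_ _)/at_right0P[|r r0 rP] := generator_cvg _ (ED _ Ex).
  by rewrite divr_gt0.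
pose s := Num.min r tau / 2.
have m0 : 0 < Num.min r tau by rewrite lt_min r0.
have mr : Num.min r tau <= r by rewrite ge_min lexx.
have mt : Num.min r tau <= tau by rewrite ge_min lexx orbT.
apply: le_trans (rnormB_trans (diff_quotient F s x) _ _) _.
have := rP s ltac:(apply/andP; rewrite /s; split; lra).
have := tauP x s t Ex ltac:(apply/andP; rewrite /s; split; lra) tP.
lra.
Qed.

Lemma generator_uniform_cvg E : strictly_inside D E ->
  {uniform E, diff_quotient F @ 0^'+ --> generator}.
Proof.
move=> sE P; rewrite uniform_nbhs => -[A [entA AP]].
move: entA; rewrite -(@entourage_from_ballE (scalar_field R k) X).
move=> -[_ /= /gt0_scalarP[e e0 ->] eA].
have [|tau tau0 tauP] := generator_unif E (e / 2) sE; first by rewrite divr_gt0.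
apply/at_right0P; exists tau => // t tP; apply: AP => x Ex.
apply: eA; apply/ball_rnorm => /=.
by apply: le_lt_trans (tauP x t Ex tP) _; lra.
Qed.

(** At one small time [t] the quotient is within 1 of the generator and has norm at most [C],
    uniformly on [E]. *)
Lemma generator_bounded E : strictly_inside D E -> bounded_set (generator @` E).
Proof.
move=> sE; have [ED _ _] := sE.
have [d d0 [C C0 CP]] := displacement_lin_bound _ sE.
have [tau tau0 tauP] := generator_unif E 1 sE ltr01.
apply: (@rnorm_bounded_set _ _ _ _ (1 + C)) => _ [x Ex <-].
pose t := Num.min d tau / 2.
have m0 : 0 < Num.min d tau by rewrite lt_min d0.
have md : Num.min d tau <= d by rewrite ge_min lexx.
have mt : Num.min d tau <= tau by rewrite ge_min lexx orbT.
have t0 : 0 < t by rewrite /t divr_gt0.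
have := rnormB_trans (diff_quotient F t x) (generator x) 0; rewrite !subr0.
have := tauP x t Ex ltac:(apply/andP; rewrite /t; split; lra).
have : rnorm (diff_quotient F t x) <= C.
  rewrite /diff_quotient -fmorphV rnormZ gtr0_norm ?invr_gt0// mulrC ler_pdivrMr//.
  by apply: CP => //; apply/andP; rewrite /t; split; lra.
lra.
Qed.

(** A locally uniform limit of continuous maps: three errors of size [e / 4], with the quotient at
    the fixed time [tau / 2] in the middle. *)
Lemma generator_cvg_within x : D x ->
  generator y @[y --> within D (nbhs x)] --> generator x.
Proof.
move=> Dx; apply/cvg_rnormP => e e0.
have [r r0 rP] := strictly_inside_ball _ _ oD Dx.
have [|tau tau0 tauP] := generator_unif _ (e / 4) rP; first by rewrite divr_gt0.
pose t := tau / 2.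
have tP : 0 < t < tau by apply/andP; rewrite /t; split; lra.
have cF : diff_quotient F t y @[y --> within D (nbhs x)] --> diff_quotient F t x.
  case: sgF => /(_ t)[|/subspace_continuousP cF _ _ _ _]; first by rewrite /t; lra.
  by apply: cvgZl_tmp; apply: cvgB; [exact: cF|exact: cvg_within].
near=> y.
have xy : rnorm (x - y) < r.
  by near: y; apply: cvg_within; apply/nbhs_rnormP; exists r.
have xx : rnorm (x - x) < r by rewrite subrr rnorm0.
have := tauP x t xx tP; have := tauP y t xy tP.
have : rnorm (diff_quotient F t x - diff_quotient F t y) < e / 4.
  by near: y; apply: (cvg_rnormP _ _).1 cF _ _; rewrite divr_gt0.
have := rnormB_trans (diff_quotient F t x) (generator x) (generator y).
have := rnormB_trans (diff_quotient F t y) (diff_quotient F t x) (generator y).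
rewrite [rnorm (_ - generator y)]rnormBC.
rewrite [rnorm (diff_quotient F t y - generator y)]rnormBC.
lra.
Unshelve. all: by end_near. Qed.

(** By the semigroup law, backward slopes are also forward quotients, started at the earlier time.
    One-sided convergence to the generator thus yields the two-sided derivative. *)
Lemma semigroup_slope s t x : 0 <= s -> 0 <= t -> s != t -> D x ->
  (ofreal k (s - t))^-1 *: (F s x - F t x) =
  diff_quotient F `|s - t| (F (Num.min s t) x).
Proof.
move=> s0 t0; case: (ltgtP s t) => // st _ Dx; case: (sgF) => _ _ FD _.
  rewrite /diff_quotient -FD ?normr_ge0//.
  rewrite ltr0_norm ?subr_lt0// opprB subrK -[s - t]opprB rmorphN invrN.
  by rewrite scaleNr -scalerN opprB.
rewrite /diff_quotient -FD ?normr_ge0//.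
by rewrite gtr0_norm ?subr_gt0// subrK.
Qed.

(** The base point [F (m s) x] moves with [s] but tends to [F t x]. Uniform convergence of quotients
    on a ball around [F t x] and continuity of the generator there cost [e / 4] each. *)
Lemma orbit_derivative t x : 0 <= t -> D x ->
  (ofreal k (s - t))^-1 *: (F s x - F t x)
    @[s --> within halfline t^'] --> generator (F t x).
Proof.
move=> t0 Dx; apply/cvg_rnormP => e e0.
have DF := semigroup_invariant _ _ t0 Dx.
have [r r0 rP] := strictly_inside_ball _ _ oD DF.
have [|tau tau0 tauP] := generator_unif _ (e / 4) rP; first by rewrite divr_gt0.
pose m s := Num.min s t.
have Dm s : 0 <= s -> D (F (m s) x).
  by move=> s0; apply: semigroup_invariant; rewrite // le_min s0.
have cm : F (m s) x @[s --> within halfline (nbhs t)] --> F t x.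
  apply/cvg_rnormP => d d0.
  have /cvg_rnormP/(_ _ d0) := orbit_cvg _ _ t0 Dx.
  apply: filterS => s; rewrite /m; case: (leP s t) => // _ _.
  by rewrite subrr rnorm0.
(* Continuity of the generator is relative to [D], hence the need for [Dm]. *)
have cgm : generator (F (m s) x) @[s --> within halfline (nbhs t)] --> generator (F t x).
  move=> P /(generator_cvg_within _ DF) /cm.
  apply: (@filterS _ (nbhs t)) => s hs s0; apply: (hs s0).
  exact: Dm.
have within_dnbhs (P : set R) : (\forall s \near within halfline (nbhs t), P s) ->
    \forall s \near within halfline t^', P s.
  by apply: (@filterS _ (nbhs t)) => s Ps _.
have st : `|s - t| @[s --> within halfline (nbhs t)] --> (0 : R).
  rewrite -[0 in X in _ --> X](normr0 R) -[0 in X in _ --> X](subrr t); apply: cvg_norm.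
  by apply: cvgB; [exact: cvg_within|exact: cvg_cst].
near=> s.
have s0 : 0 <= s by near: s; exact: near_withinT.
have sNt : s != t.
  by near: s; apply: cvg_within; exact: nbhs_dnbhs_neq.
rewrite semigroup_slope//.
have s_tau : 0 < `|s - t| < tau.
  rewrite normr_gt0 subr_eq0 sNt/=; near: s; apply: within_dnbhs.
  exact: cvgr_lt st _ tau0.
have Fr : rnorm (F t x - F (m s) x) < r.
  by near: s; apply: within_dnbhs; exact: (cvg_rnormP _ _).1 cm _ r0.
have gr : rnorm (generator (F t x) - generator (F (m s) x)) < e / 4.
  near: s; apply: within_dnbhs; apply: (cvg_rnormP _ _).1 cgm _ _.
  by rewrite divr_gt0.
have := tauP _ _ Fr s_tau.
have := rnormB_trans (generator (F (m s) x)) (generator (F t x))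
  (diff_quotient F `|s - t| (F (m s) x)).
rewrite -/(m s); lra.
Unshelve. all: by end_near. Qed.

End Semigroup.

Theorem theorem3p1 (R : realType) (k : scalar_kind)
    (X : completeNormedModType (scalar_field R k)) (D : set X) (F : R -> X -> X) :
  domain D -> semigroup D F -> T_continuous D F -> T_Lipschitzian D F ->
  exists f : X -> X,
    [/\ forall x, D x -> diff_quotient F t x @[t --> 0^'+] --> f x,
        forall E, strictly_inside D E ->
          {uniform E, diff_quotient F @ 0^'+ --> f},
        {within D, continuous f},
        forall E, strictly_inside D E -> bounded_set (f @` E)
      & solves_Cauchy D f F].
Proof.
move=> [oD _] sgF TF LF; exists (generator F); split.
- by move=> x; exact: generator_cvg.
- by move=> E; exact: generator_uniform_cvg.
- by apply/subspace_continuousP => x; exact: generator_cvg_within.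
- by move=> E; exact: generator_bounded.
- move=> x Dx; split=> [|t t0]; first exact: semigroup0 Dx.
  by split; [exact: (semigroup_invariant _ _ sgF)|exact: (orbit_derivative _ _ oD sgF)].
Qed.
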